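(* Let $\mathbb{G}$ be a homogeneous Lie group of homogeneous dimension $Q$, $|\cdot|$ any homogeneous quasi-norm on $\mathbb{G}$, $1<p<\infty$ and $\alpha\in\mathbb{R}$. Then for all complex-valued $f\in C_0^\infty(\mathbb{G}\setminus\{0\})$, $$\left|\frac{Q-\alpha}{p}\right|^p\left\|\frac{f}{|x|^{\alpha/p}}\right\|_{L^p(\mathbb{G})}^p=\left\|\frac{\mathcal{R}_{|x|}f}{|x|^{\alpha/p-1}}\right\|_{L^p(\mathbb{G})}^p-\int_{\mathbb{G}}C_p\!\left(\frac{\mathcal{R}_{|x|}f}{|x|^{\alpha/p-1}},\;\frac{\mathcal{R}_{|x|}f}{|x|^{\alpha/p-1}}+\frac{Q-\alpha}{p}\frac{f}{|x|^{\alpha/p}}\right)dx.$$ Consequently $\left|\frac{Q-\alpha}{p}\right|^p\|f/|x|^{\alpha/p}\|_{L^p(\mathbb{G})}^p\le\|\mathcal{R}_{|x|}f/|x|^{\alpha/p-1}\|_{L^p(\mathbb{G})}^p$. Moreover, if $p\ge2$, the integral of $C_p$ above vanishes only if $f(x)=|x|^{-(Q-\alpha)/p}\varphi(x/|x|)$ for some $\varphi:\mathfrak{S}\to\mathbb{C}$, which for $f\in C_0^\infty(\mathbb{G}\setminus\{0\})$ forces $f=0$; hence for $p\ge 2$ the last inequality is strict for every nonzero $f$ (the constant is not attained).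
   Context: A homogeneous Lie group is a connected simply connected (nilpotent) Lie group $\mathbb{G}$, identified with $\mathbb{R}^n$, whose Lie algebra carries dilations $D_\lambda=\exp(A\ln\lambda)$, $\lambda>0$, with $A$ diagonalisable with positive eigenvalues and each $D_\lambda$ a Lie algebra automorphism; these induce dilations $x\mapsto\lambda x$ on $\mathbb{G}$. The homogeneous dimension is $Q=\operatorname{Tr}A$, and the Haar measure $dx$ (Lebesgue measure) satisfies $\int f(\lambda x)dx=\lambda^{-Q}\int f(x)dx$. A homogeneous quasi-norm is a continuous $|\cdot|:\mathbb{G}\to[0,\infty)$ with $|x^{-1}|=|x|$, $|\lambda x|=\lambda|x|$, and $|x|=0$ iff $x=0$. $\mathfrak{S}=\{x:|x|=1\}$; there is a positive Borel measure $\sigma$ on $\mathfrak{S}$ with $\int_{\mathbb{G}}f\,dx=\int_0^\infty\int_{\mathfrak{S}}f(ry)r^{Q-1}d\sigma(y)dr$. The radial derivative is $\mathcal{R}_{|x|}f(x)=\frac{d}{dr}f(ry)$ evaluated at $r=|x|$, $y=x/|x|$. For complex $\xi,\eta$, $C_p(\xi,\eta):=|\xi|^p-|\xi-\eta|^p-p|\xi-\eta|^{p-2}\operatorname{Re}((\xi-\eta)\overline{\eta})$ (last term $0$ when $\xi=\eta$). *)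

(* Defs.v *)
From HB Require Import structures.
From mathcomp Require Import all_boot all_order all_algebra.
From mathcomp Require Import complex.
From mathcomp Require Import all_classical all_reals all_analysis.
Set Implicit Arguments.
Unset Strict Implicit.
Unset Printing Implicit Defensive.
Import Order.TTheory GRing.Theory Num.Theory.
Import numFieldNormedType.Exports.
Local Open Scope classical_set_scope.
Local Open Scope ring_scope.

Section HomogeneousGroup.
Variables (R : realType) (n : nat).
Local Notation V := 'rV[R]_n.

(* Dilations on G = R^n (exponential coordinates in an eigenbasis of A):
   D_lambda = exp(A ln lambda) is diagonal with eigenvalues lambda^(w i). *)
Definition hdil (w : 'I_n -> R) (l : R) (x : V) : V :=
  \row_(i < n) (l `^ (w i) * x 0 i).

(* homogeneous dimension Q = Tr A *)
Definition hdim (w : 'I_n -> R) : R := \sum_(i < n) w i.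

Definition is_homogeneous_group (w : 'I_n -> R) (mul : V -> V -> V)
    (inv : V -> V) : Prop :=
  (forall i, 0 < w i) /\
  [/\ forall x y z, mul x (mul y z) = mul (mul x y) z,
      forall x, mul 0 x = x /\ mul x 0 = x,
      forall x, mul x (inv x) = 0 /\ mul (inv x) x = 0,
      continuous (fun xy : V * V => mul xy.1 xy.2) &
      forall l x y, 0 < l -> hdil w l (mul x y) = mul (hdil w l x) (hdil w l y)].

Definition is_quasi_norm (w : 'I_n -> R) (inv : V -> V) (qn : V -> R) : Prop :=
  [/\ continuous qn,
      forall x, 0 <= qn x,
      forall x, qn (inv x) = qn x,
      forall l x, 0 < l -> qn (hdil w l x) = l * qn x &
      forall x, qn x = 0 <-> x = 0].

Fixpoint ideriv (vs : seq V) (f : V -> R) : V -> R :=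
  match vs with
  | [::] => f
  | v :: vs' => 'D_v (ideriv vs' f)
  end.

Definition smooth (f : V -> R) : Prop :=
  forall vs : seq V, continuous (ideriv vs f) /\
    (forall x v, derivable (ideriv vs f) x v).

Definition test_fun (f : V -> R[i]) : Prop :=
  smooth (fun x => complex.Re (f x)) /\ smooth (fun x => complex.Im (f x)) /\
  exists K : set V, [/\ compact K, ~ K 0 & forall x, ~ K x -> f x = 0].

(* radial derivative: d/dr f(r y) at r = |x|, y = x/|x| := D_{1/|x|} x *)
Definition radial_deriv_R (w : 'I_n -> R) (qn : V -> R) (g : V -> R) (x : V) : R :=
  derive1 (fun r => g (hdil w r (hdil w (qn x)^-1 x))) (qn x).

Definition radial_deriv (w : 'I_n -> R) (qn : V -> R) (f : V -> R[i]) (x : V)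
  : R[i] :=
  Complex (radial_deriv_R w qn (fun y => complex.Re (f y)) x)
          (radial_deriv_R w qn (fun y => complex.Im (f y)) x).

(* Lebesgue integral on R^n, written as iterated one-dimensional Lebesgue
   integrals *)
Fixpoint iter_int (m : nat) : (seq R -> R) -> R :=
  match m with
  | 0 => fun F => F [::]
  | m'.+1 => fun F =>
      Rintegral (@lebesgue_measure R) [set: R]
        (fun t => iter_int m' (fun s => F (t :: s)))
  end.

Definition row_of_seq (s : seq R) : V := \row_(i < n) nth 0 s i.

Definition Gint (g : V -> R) : R := iter_int n (fun s => g (row_of_seq s)).

End HomogeneousGroup.

Definition cabs (R : rcfType) (z : R[i]) : R :=
  Num.sqrt (complex.Re z ^+ 2 + complex.Im z ^+ 2).

Definition Cp (R : realType) (p : R) (xi eta : R[i]) : R :=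
  cabs xi `^ p - cabs (xi - eta) `^ p -
  (if xi == eta then 0
   else p * cabs (xi - eta) `^ (p - 2) * complex.Re ((xi - eta) * conjc eta)).

Definition RC (R : realType) (r : R) : R[i] := Complex r 0.

(* Main.v *)
Require Import Defs.
From HB Require Import structures.
From mathcomp Require Import all_boot all_order all_algebra.
From mathcomp Require Import complex.
From mathcomp Require Import all_classical all_reals all_analysis.
From mathcomp Require Import ring lra.
Set Implicit Arguments.
Unset Strict Implicit.
Unset Printing Implicit Defensive.
Import Order.TTheory GRing.Theory Num.Theory.
Import numFieldNormedType.Exports.
Local Open Scope classical_set_scope.
Local Open Scope ring_scope.

(** Write E = sum_i w_i x_i d_i for the generator of the dilations, so that
    |x| R f = E f, and c = (Q - alpha) / p.  With q = |x|^(- alpha / p) the two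
    functions in the statement are u = f q and v = (E f) q, and expanding C_p
    gives
      C_p (v, v + c u) = |v|^p + (p - 1) |c|^p |u|^p
                         + p |c|^(p-2) c |u|^(p-2) Re (u conj v).
    As p |f|^(p-2) Re (f conj (E f)) = E (|f|^p), the identity amounts to
      int E (|f|^p) |x|^(- alpha) dx = (alpha - Q) int |f|^p |x|^(- alpha) dx,
    which is obtained, without polar coordinates, by differentiating at l = 1
    the scaling relation
      int |f (l x)|^p |x|^(- alpha) dx = l^(alpha - Q) int |f|^p |x|^(- alpha) dx.
    C_p is nonnegative and C_p (xi, eta) = 0 only for eta = 0, by strict
    convexity of |.|^p.  Hence a vanishing remainder gives E f = - c f, so f is
    homogeneous of degree - c along the dilations, which compact support
    excludes unless f = 0.  All integrands are continuous with compact support;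
    for such functions the iterated integral is handled by induction on the
    number of variables. *)

(** * One-dimensional integrals *)

Section Integral1.
Variable R : realType.
Notation mu := (@lebesgue_measure R).
Implicit Types (f g : R -> R) (M : R).

Lemma supp_patchE f M : (forall x, M < `|x| -> f x = 0) -> f \_ `[- M, M] = f.
Proof.
move=> f0; apply/funext => x; rewrite patchE; case: ifPn => // xM.
rewrite f0// ltNge; apply: contra xM => xM.
by rewrite inE /= in_itv /= -ler_norml.
Qed.

Lemma integrable_supp f M : continuous f -> (forall x, M < `|x| -> f x = 0) ->
  mu.-integrable setT (EFin \o f).
Proof.
move=> cf f0; rewrite -(supp_patchE f0) -restrict_EFin.
apply: (iffLR (integrable_mkcond _ _)) => //.
apply: continuous_compact_integrable; first exact: segment_compact.
exact: continuous_subspaceT.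
Qed.

Lemma integrable_cst_patch (a b k : R) :
  mu.-integrable setT (EFin \o ((cst k : R -> R) \_ `[a, b])).
Proof.
rewrite -restrict_EFin; apply: (iffLR (integrable_mkcond _ _)) => //.
apply: continuous_compact_integrable; first exact: segment_compact.
by apply: continuous_subspaceT => x; exact: cvg_cst.
Qed.

Lemma Rintegral_cst_patch (a b k : R) : a <= b ->
  Rintegral mu setT ((cst k : R -> R) \_ `[a, b]) = k * (b - a).
Proof.
move=> ab; rewrite -Rintegral_mkcond Rintegral_cst//; congr (_ * _).
rewrite /= lebesgue_measure_itv /= lte_fin; case: ltgtP ab => //= -> _.
by rewrite subrr.
Qed.

(** Domination by the step function equal to [e] on the segment from [- M] to [M]. *)
Lemma Rintegral_bound f (M e : R) : 0 <= M -> continuous f ->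
  (forall x, M < `|x| -> f x = 0) -> (forall x, `|f x| <= e) ->
  `|Rintegral mu setT f| <= e * (2 * M).
Proof.
move=> M0 cf f0 fe; have intf := integrable_supp cf f0.
apply: le_trans (le_normr_Rintegral _ intf) _ => //.
rewrite (_ : e * (2 * M) = Rintegral mu setT ((cst e : R -> R) \_ `[- M, M])).
  apply: le_Rintegral => //.
  - by move/integrable_norm : intf.
  - exact: integrable_cst_patch.
  - move=> x _; rewrite /patch; case: ifPn => //= xM.
    rewrite f0 ?normr0// ltNge; apply: contra xM => xM.
    by rewrite inE /= in_itv /= -ler_norml.
by rewrite Rintegral_cst_patch; [ring|lra].
Qed.

(** By continuity [f] exceeds half of [f x0] on a ball around [x0], so it dominates a step function
    carried by a smaller closed interval, whose integral is positive. *)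
Lemma Rintegral_gt0 f M x0 : continuous f ->
  (forall x, M < `|x| -> f x = 0) -> (forall x, 0 <= f x) -> 0 < f x0 ->
  0 < Rintegral mu setT f.
Proof.
move=> cf f0 fge fx0.
have hx0 : 0 < f x0 / 2 by lra.
have /nbhs_ballP[d /= d0 dP] : \forall x \near x0, f x0 / 2 < f x.
  by apply: (@cvgr_gt _ R (nbhs x0) _ f (f x0)) => //; [exact: cf | lra].
have : 0 < f x0 / 2 * ((x0 + d / 2) - (x0 - d / 2)) by apply: mulr_gt0; lra.
move/lt_le_trans; apply.
rewrite -Rintegral_cst_patch; last lra.
apply: le_Rintegral => //.
- exact: integrable_cst_patch.
- exact: (integrable_supp cf f0).
- move=> x _; rewrite /patch; case: ifPn => /= [|_]; last exact: fge.
  rewrite inE /= in_itv /= => /andP[x1 x2]; apply/ltW/dP.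
  by rewrite /ball /= ltr_norml; apply/andP; split; lra.
Qed.

Lemma Rintegral_scale f (M a : R) : 0 < a -> continuous f ->
  (forall x, M < `|x| -> f x = 0) ->
  Rintegral mu setT (fun x => f (a * x)) = a^-1 * Rintegral mu setT f.
Proof.
move=> a0 cf f0.
(* [M] may have any sign; a positive [N] above it keeps the endpoints of the substitution interval
   ordered. *)
pose N := Num.max M 0 + 1.
have N0 : 0 < N by rewrite ltr_wpDl// le_max lexx orbT.
have MN : M <= N by rewrite (@le_trans _ _ (Num.max M 0))// ?le_max ?lexx// lerDl.
have fN x : N < `|x| -> f x = 0 by move=> ?; apply: f0; exact: le_lt_trans MN _.
have faN x : a^-1 * N < `|x| -> f (a * x) = 0.
  move=> xN; apply: fN; rewrite normrM gtr0_norm//.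
  by rewrite -(ltr_pM2l (x := a^-1)) ?invr_gt0// mulKf// gt_eqF.
have cfa : continuous (fun x => f (a * x)).
  move=> x; apply: (@continuous_comp _ _ _ (fun x => a * x) f); last exact: cf.
  exact: mulrl_continuous.
rewrite -[in RHS](supp_patchE fN) -Rintegral_mkcond.
rewrite -[in LHS](supp_patchE faN) -Rintegral_mkcond.
pose F := (fun x : R => a * x) : R -> R.
have dF : derive1 F = cst a.
  apply/funext => x; rewrite derive1E.
  by rewrite /F deriveMl// derive_id /= mulr1.
have : (\int[mu]_(x in `[F (- (a^-1 * N))%R, F (a^-1 * N)%R]) (f x)%:E =
  \int[mu]_(x in `[(- (a^-1 * N))%R, (a^-1 * N)%R]) (((f \o F) * derive1 F)%R x)%:E)%E.
  apply: integration_by_substitution_increasing.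
  - by rewrite ge0_cp ?mulr_ge0 ?invr_ge0 ?ltW.
  - by move=> x y _ _ xy; rewrite /F ltr_pM2l.
  - by move=> x _; rewrite dF; exact: cvg_cst.
  - by rewrite dF; exact: is_cvg_cst.
  - by rewrite dF; exact: is_cvg_cst.
  - split.
    + by move=> x _; rewrite /F; exact: derivableM.
    + apply: cvg_at_right_filter; exact: mulrl_continuous.
    + apply: cvg_at_left_filter; exact: mulrl_continuous.
  - exact: continuous_subspaceT.
rewrite /F mulrN mulrA divff ?gt_eqF// mul1r => E.
rewrite [in RHS]/Rintegral E.
rewrite -[LHS](mulKf (_ : a != 0)) ?gt_eqF//; congr (_ * _).
rewrite -RintegralZl//.
  by apply: eq_Rintegral => x _; rewrite /= -/F dF /F /= mulrC.
apply: continuous_compact_integrable; first exact: segment_compact.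
exact: continuous_subspaceT.
Qed.

End Integral1.

(** * Iterated integrals *)

Section IteratedIntegral.
Variable R : realType.
Notation mu := (@lebesgue_measure R).
Implicit Types (F G : seq R -> R) (M e k d : R) (m : nat).

(* [nth] returns 0 past the end of a sequence, so indices i >= m are harmless. *)
Definition ucc m M F : Prop :=
  (forall s i, size s = m -> M < `|nth 0 s i| -> F s = 0) /\
  (forall e, 0 < e -> exists2 d, 0 < d & forall s t, size s = m -> size t = m ->
     (forall i, `|nth 0 s i - nth 0 t i| < d) -> `|F s - F t| < e).

Lemma iter_int_ext m F G : (forall s, size s = m -> F s = G s) ->
  iter_int m F = iter_int m G.
Proof.
elim: m F G => [|m IH] F G FG /=; first exact: FG.
by apply: eq_Rintegral => t _; apply: IH => s sm; apply: FG; rewrite /= sm.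
Qed.

Lemma iter_int0 m F : (forall s, size s = m -> F s = 0) -> iter_int m F = 0.
Proof.
move=> F0; rewrite (iter_int_ext (G := fun=> 0))//.
elim: m {F F0} => //= m IH.
rewrite (_ : (fun t => _) = cst 0); last by apply/funext => t; exact: IH.
by rewrite Rintegral_cst// mul0r.
Qed.

Lemma ucc_cons m M F t : ucc m.+1 M F -> ucc m M (fun s => F (t :: s)).
Proof.
move=> [F0 Fc]; split.
  by move=> s i sm sM; apply: (F0 (t :: s) i.+1) => //=; rewrite sm.
move=> e e0; have [d d0 dP] := Fc e e0; exists d => // s s' sm s'm ss'.
apply: dP; rewrite /= ?sm ?s'm// => -[|i] /=; last exact: ss'.
by rewrite subrr normr0.
Qed.

Lemma ucc_lin m M F G k : ucc m M F -> ucc m M G ->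
  ucc m M (fun s => F s + k * G s).
Proof.
move=> [F0 Fc] [G0 Gc]; split.
  by move=> s i sm sM; rewrite (F0 _ _ sm sM) (G0 _ _ sm sM) mulr0 addr0.
move=> e e0.
have k0 : 0 < `|k| + 1 by rewrite ltr_wpDl.
have [|d1 d10 d1P] := Fc (e / 2); first lra.
have [|d2 d20 d2P] := Gc (e / 2 / (`|k| + 1)); first by rewrite divr_gt0//; lra.
exists (Num.min d1 d2); first by rewrite lt_min d10.
move=> s t sm tm st.
rewrite (_ : _ - _ = (F s - F t) + k * (G s - G t)); last by ring.
rewrite (le_lt_trans (ler_normD _ _))// [ltRHS](_ : _ = e / 2 + e / 2); last lra.
apply: ltr_leD.
  by apply: d1P => // i; have := st i; rewrite lt_min => /andP[].
rewrite normrM.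
have : `|G s - G t| < e / 2 / (`|k| + 1).
  by apply: d2P => // i; have := st i; rewrite lt_min => /andP[].
rewrite ltr_pdivlMr// => H; apply: le_trans (ltW H).
by rewrite mulrC ler_wpM2l// lerDl.
Qed.

Lemma iter_int_cons_supp m M F t : ucc m.+1 M F -> M < `|t| ->
  iter_int m (fun s => F (t :: s)) = 0.
Proof.
by move=> uF tM; apply: iter_int0 => s sm; apply: (uF.1 _ 0); rewrite /= ?sm.
Qed.

(** By linearity the difference of two slices is the integral of one function, which uniform
    continuity makes small everywhere; the bound then controls its integral. Bound and linearity
    enter as hypotheses so that the result can serve inside the induction that proves them. *)
Lemma ucc_cons_cont m M F : 0 <= M -> ucc m.+1 M F ->
  (forall G e, ucc m M G -> (forall s, size s = m -> `|G s| <= e) ->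
     `|iter_int m G| <= e * (2 * M) ^+ m) ->
  (forall F1 G k, ucc m M F1 -> ucc m M G ->
     iter_int m (fun s => F1 s + k * G s) = iter_int m F1 + k * iter_int m G) ->
  continuous (fun t => iter_int m (fun s => F (t :: s))).
Proof.
move=> M0 uF bnd lin x; apply/cvgrPdist_lt => e e0.
have M20 : 0 < (2 * M) ^+ m + 1 by rewrite ltr_wpDl// exprn_ge0//; lra.
(* Adding 1 keeps the divisor positive even when the volume is 0, and makes the final estimate
   strict. *)
have [d d0 dP] := uF.2 (e / ((2 * M) ^+ m + 1)) (divr_gt0 e0 M20).
apply/nbhs_ballP; exists d => //= y xy.
rewrite -[X in _ - X]mul1r -mulNr -lin; try exact: ucc_cons.
apply: (@le_lt_trans _ _ (e / ((2 * M) ^+ m + 1) * (2 * M) ^+ m)).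
  apply: bnd; first by apply: ucc_lin; exact: ucc_cons.
  move=> s sm; rewrite mulN1r; apply/ltW/dP; rewrite /= ?sm// => -[|i] //=.
  by rewrite subrr normr0.
by rewrite mulrAC -mulrA gtr_pMr// ltr_pdivrMr// mul1r ltrDl.
Qed.

(* The two claims are proved jointly: at m.+1 the inner integral must be
   continuous in the first variable, and this uses both claims at m. *)
Lemma iter_int_step m M : 0 <= M ->
  (forall G e, ucc m M G -> (forall s, size s = m -> `|G s| <= e) ->
     `|iter_int m G| <= e * (2 * M) ^+ m) /\
  (forall F1 G k, ucc m M F1 -> ucc m M G ->
     iter_int m (fun s => F1 s + k * G s) = iter_int m F1 + k * iter_int m G).
Proof.
move=> M0; elim: m => [|m [bnd lin]].
  by split=> //= G e _ Ge; rewrite mulr1; exact: Ge.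
have cont F := fun uF : ucc m.+1 M F => ucc_cons_cont M0 uF bnd lin.
have supp F := fun uF : ucc m.+1 M F => @iter_int_cons_supp m M F ^~ uF.
split=> [G e uG Ge|F1 G k uF uG] /=.
  rewrite exprSr mulrA; apply: Rintegral_bound => //.
  - exact: cont.
  - exact: supp.
  - move=> x; apply: bnd; first exact: ucc_cons.
    by move=> s sm; apply: Ge; rewrite /= sm.
have iF := integrable_supp (cont _ uF) (supp _ uF).
have iG := integrable_supp (cont _ uG) (supp _ uG).
rewrite -RintegralZl// -RintegralD//.
  by apply: eq_Rintegral => t _; rewrite lin//; exact: ucc_cons.
by have := integrableZl measurableT k iG; exact.
Qed.

Lemma iter_int_bound m M G e : 0 <= M -> ucc m M G ->
  (forall s, size s = m -> `|G s| <= e) -> `|iter_int m G| <= e * (2 * M) ^+ m.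
Proof. by move=> M0; have [+ _] := iter_int_step m M0; exact. Qed.

Lemma iter_int_lin m M F G k : 0 <= M -> ucc m M F -> ucc m M G ->
  iter_int m (fun s => F s + k * G s) = iter_int m F + k * iter_int m G.
Proof. by move=> M0; have [_ +] := iter_int_step m M0; exact. Qed.

Lemma iter_int_cons_cont m M F : 0 <= M -> ucc m.+1 M F ->
  continuous (fun t => iter_int m (fun s => F (t :: s))).
Proof. by move=> M0 uF; have [] := iter_int_step m M0; exact: ucc_cons_cont. Qed.

Lemma iter_int_ge0 m F : (forall s, size s = m -> 0 <= F s) -> 0 <= iter_int m F.
Proof.
elim: m F => [|m IH] F F0 /=; first exact: F0.
by apply: Rintegral_ge0 => t _; apply: IH => s sm; apply: F0; rewrite /= sm.
Qed.

(** Positivity propagates outwards: the inner integral is positive at the head of [s0] by induction,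
    and it is continuous and nonnegative in the first variable. *)
Lemma iter_int_gt0 m M F s0 : 0 <= M -> ucc m M F ->
  (forall s, size s = m -> 0 <= F s) -> size s0 = m -> 0 < F s0 ->
  0 < iter_int m F.
Proof.
move=> M0; elim: m F s0 => [|m IH] F s0 uF F0 s0m Fs0 /=.
  by rewrite -(size0nil s0m).
case: s0 s0m Fs0 => //= t s0 [s0m] Fs0.
apply: (@Rintegral_gt0 _ _ M t).
- exact: iter_int_cons_cont uF.
- by move=> x; exact: iter_int_cons_supp.
- by move=> x; apply: iter_int_ge0 => s sm; apply: F0; rewrite /= sm.
- apply: (IH _ s0) => //; first exact: ucc_cons.
  by move=> s sm; apply: F0; rewrite /= sm.
Qed.

(** One substitution per variable. The factors are indexed by [nat] so that the induction can pass
    to the shifted family [a i.+1]. *)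
Lemma iter_int_scale m M (a : nat -> R) F : 0 <= M -> ucc m M F ->
  (forall i, 0 < a i) ->
  iter_int m (fun s => F (mkseq (fun i => a i * nth 0 s i) m)) =
  (\prod_(i < m) a i)^-1 * iter_int m F.
Proof.
move=> M0; elim: m a F => [|m IH] a F uF a0 /=.
  by rewrite big_ord0 invr1 mul1r.
rewrite big_ord_recl invfM -mulrA mulrCA.
rewrite -(Rintegral_scale (M := M) (a0 0)); last 2 first.
- exact: iter_int_cons_cont uF.
- by move=> x; exact: iter_int_cons_supp.
rewrite -RintegralZl//; last first.
  apply: (@integrable_supp _ _ ((a 0)^-1 * M)).
    move=> x; apply: (@continuous_comp _ _ _ (fun x => a 0 * x)
      (fun t => iter_int m (fun s => F (t :: s)))).
      exact: mulrl_continuous.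
    exact: iter_int_cons_cont uF _.
  move=> x xM; apply: iter_int_cons_supp uF _; rewrite normrM gtr0_norm//.
  by rewrite -(ltr_pM2l (x := (a 0)^-1)) ?invr_gt0// mulKf// gt_eqF.
apply: eq_Rintegral => t _.
rewrite -(IH (fun i => a i.+1) (fun s => F (a 0 * t :: s)))//; last first.
  exact: ucc_cons.
apply: iter_int_ext => s sm; congr F.
by rewrite /mkseq /= -[1%N]add1n iotaDl -map_comp.
Qed.

End IteratedIntegral.

Section ContinuousArith.
Variables (R : realType) (T : topologicalType).
Implicit Types f g : T -> R.

Lemma continuous_addr f g : continuous f -> continuous g ->
  continuous (fun x => f x + g x).
Proof. by move=> cf cg x; apply: continuousD; [exact: cf|exact: cg]. Qed.

Lemma continuous_mulr f g : continuous f -> continuous g ->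
  continuous (fun x => f x * g x).
Proof. by move=> cf cg x; apply: continuousM; [exact: cf|exact: cg]. Qed.

Lemma continuous_dist_lt f x (e : R) : {for x, continuous f} -> 0 < e ->
  \forall y \near x, `|f x - f y| < e.
Proof. by move=> /cvgrPdist_lt; exact. Qed.

Lemma continuous_cstr (k : R) : continuous (fun _ : T => k).
Proof. by move=> x; exact: cvg_cst. Qed.

End ContinuousArith.

(** * Integrals over R^n of continuous functions supported in a box *)

Section GintTheory.
Variables (R : realType) (n : nat).
Notation V := 'rV[R]_n.
Implicit Types (g h : V -> R) (M e k d : R) (x y : V).

Lemma rV_ballE x y d : 0 < d -> ball x d y <-> forall i, `|x 0 i - y 0 i| < d.
Proof.
move=> d0; split=> [[_ H] i|H]; first by have := H 0 i.
by split => // i j; rewrite ord1; exact: H.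
Qed.

Definition csupp M g : Prop :=
  continuous g /\ forall x i, M < `|x 0 i| -> g x = 0.

Lemma box_compact M : compact [set x : V | forall i, `|x 0 i| <= M].
Proof.
have := @rV_compact R n (fun=> `[- M, M]%classic) (fun=> @segment_compact _ _ _).
congr compact; apply/seteqP.
by split=> x /= H i; have := H i; rewrite ?in_itv /= -ler_norml.
Qed.

(** Heine-Cantor: the near-covering form of compactness yields one radius for a box slightly larger
    than the support, and beyond that box both values are 0. *)
Lemma csupp_unif M g e : csupp M g -> 0 < e -> exists2 d : R, 0 < d &
  forall x y, (forall i, `|x 0 i - y 0 i| < d) -> `|g x - g y| < e.
Proof.
move=> [cg g0] e0.
have : compact [set x : V | forall i, `|x 0 i| <= M + 1] by exact: box_compact.
move=> /compact_near_coveringP.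
move=> /(_ R (0^'+) (fun d x => forall y, ball x d y -> `|g x - g y| < e)).
case.
  move=> x _; have /cvgrPdist_lt /(_ (e / 2)) := cg x.
  have e20 : 0 < e / 2 by lra.
  move=> /(_ e20) /nbhs_ballP[d /= d0 dP].
  exists (ball x (d / 2), [set r | 0 < r < d / 2]).
    split => /=; first by apply: nbhsx_ballx; lra.
    by near=> r; apply/andP; split; [done|near: r; apply: nbhs_right_lt; lra].
  move=> [z r] /= [xz /andP[r0 rd]] y zy.
  have xy : ball x d y.
    rewrite [d]splitr; apply: ball_triangle xz _.
    by apply: le_ball zy; exact: ltW.
  have {}xz : ball x d z by apply: le_ball xz; lra.
  have := dP _ xy; have := dP _ xz => /= H1 H2.
  rewrite (_ : g z - g y = (g x - g y) - (g x - g z)); last by ring.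
  by rewrite (le_lt_trans (ler_normB _ _))// [ltRHS]splitr ltrD.
move=> d0 /= d00 H.
(* With [d] at most 1, a point within [d] of the outside of the box of half-width [M + 1] still lies
   outside the box of half-width [M]. *)
pose d := Num.min (d0 / 2) 1.
have dgt0 : 0 < d by rewrite lt_min ltr01 andbT divr_gt0.
have d1 : d <= 1 by rewrite ge_min lexx orbT.
exists d => // x y xy.
have [xM|] := pselect (forall i, `|x 0 i| <= M + 1).
  apply: (H d) => //=; last exact/rV_ballE.
  rewrite sub0r normrN gtr0_norm// (le_lt_trans (y := d0 / 2))//.
    by rewrite ge_min lexx.
  by rewrite ltr_pdivrMr// ltr_pMr// ltr1n.
move=> /existsNP[i /negP]; rewrite -ltNge => xM.
have yM : M < `|y 0 i|.
  have := xy i; have : `|x 0 i| <= `|x 0 i - y 0 i| + `|y 0 i|.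
    by rewrite -[in leLHS](subrK (y 0 i) (x 0 i)) ler_normD.
  by lra.
rewrite (g0 _ _ yM) (g0 x i) ?subrr ?normr0//; lra.
Unshelve. all: by end_near. Qed.

Lemma csupp_ucc M g : 0 <= M -> csupp M g ->
  ucc n M (fun s => g (row_of_seq n s)).
Proof.
move=> M0 cg; split.
  move=> s i sn sM; have ni : (i < n)%N.
    rewrite ltnNge; apply/negP => ni; move: sM.
    by rewrite nth_default ?sn// normr0 ltNge M0.
  by apply: (cg.2 _ (Ordinal ni)); rewrite mxE.
move=> e e0; have [d d0 dP] := csupp_unif cg e0.
by exists d => // s t _ _ st; apply: dP => i; rewrite !mxE.
Qed.

Lemma csupp_le M M' g : M <= M' -> csupp M g -> csupp M' g.
Proof.
by move=> MM' [cg g0]; split=> // x i xM; apply: (g0 x i); exact: le_lt_trans xM.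
Qed.

Lemma csupp_lin M g h k : csupp M g -> csupp M h ->
  csupp M (fun x => g x + k * h x).
Proof.
move=> [cg g0] [ch h0]; split.
  by apply: continuous_addr => //; apply: continuous_mulr => //; exact: continuous_cstr.
by move=> x i xM; rewrite (g0 _ _ xM) (h0 _ _ xM) mulr0 addr0.
Qed.

Lemma Gint_lin M g h k : 0 <= M -> csupp M g -> csupp M h ->
  Gint (fun x => g x + k * h x) = Gint g + k * Gint h.
Proof.
move=> M0 cg ch.
exact: (iter_int_lin k M0 (csupp_ucc M0 cg) (csupp_ucc M0 ch)).
Qed.

Lemma Gint_ge0 g : (forall x, 0 <= g x) -> 0 <= Gint g.
Proof. by move=> g0; apply: iter_int_ge0. Qed.

Lemma Gint_gt0 M g x : 0 <= M -> csupp M g -> (forall x, 0 <= g x) ->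
  0 < g x -> 0 < Gint g.
Proof.
move=> M0 cg g0 gx.
apply: (iter_int_gt0 (s0 := [seq x 0 i | i <- enum 'I_n]) M0 (csupp_ucc M0 cg)).
- by move=> s _; exact: g0.
- by rewrite size_map size_enum_ord.
- rewrite (_ : row_of_seq _ _ = x)//; apply/rowP => i; rewrite mxE.
  by rewrite (nth_map i) ?size_enum_ord// nth_ord_enum.
Qed.

Lemma Gint_bound M g e : 0 <= M -> csupp M g -> (forall x, `|g x| <= e) ->
  `|Gint g| <= e * (2 * M) ^+ n.
Proof.
by move=> M0 cg ge; apply: (iter_int_bound M0 (csupp_ucc M0 cg)) => s _; exact: ge.
Qed.

Lemma Gint_dil (w : 'I_n -> R) M g l : 0 <= M -> csupp M g -> 0 < l ->
  Gint (fun x => g (hdil w l x)) = l `^ (- hdim w) * Gint g.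
Proof.
move=> M0 cg l0.
(* The factor 1 past [n] keeps [a] positive on all of [nat], as [iter_int_scale] requires. *)
pose a (i : nat) := if insub i is Some j then l `^ w j else 1.
have aE (i : 'I_n) : a i = l `^ w i by rewrite /a valK.
have a0 i : 0 < a i by rewrite /a; case: insub => [j|]; rewrite ?powR_gt0.
have <- : (\prod_(i < n) a i)^-1 = l `^ (- hdim w).
  rewrite powRN; congr (_^-1); rewrite /hdim.
  have lD : {morph powR l : x y / x + y >-> x * y}.
    by move=> x y; rewrite powRD//; apply/implyP => _; rewrite gt_eqF.
  by rewrite (big_morph _ lD (powRr0 l)); apply: eq_bigr => i _.
rewrite /Gint -(iter_int_scale M0 (csupp_ucc M0 cg))//.
apply: iter_int_ext => s sn; congr g; apply/rowP => i.
by rewrite !mxE nth_mkseq// aE.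
Qed.

End GintTheory.

(** * Derivatives along dilations *)

Section MeanValue.
Variable R : realType.

(** The endpoints come in either order because increments of unknown sign and dilation ratios on
    both sides of 1 occur below. *)
Lemma MVT_minmax (f df : R -> R) (a b : R) :
  (forall x, Num.min a b <= x <= Num.max a b -> is_derive x (1 : R) f (df x)) ->
  exists2 c, Num.min a b <= c <= Num.max a b & f b - f a = df c * (b - a).
Proof.
wlog ab : a b / a <= b => [H|].
  case/orP: (le_total a b) => [ab|ba]; first exact: H.
  rewrite minC maxC => fd; have [c cba E] := H _ _ ba fd.
  by exists c => //; rewrite -opprB E -mulrN opprB.
rewrite min_l// max_r// => fd.
have [] := @MVT_segment R f df a b ab.
- by move=> x; rewrite in_itv /= => /andP[/ltW ax /ltW xb]; apply: fd; rewrite ax.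
- apply: derivable_within_continuous => x; rewrite in_itv /= => xab.
  by have [] := fd x xab.
- by move=> c; rewrite in_itv /=; exists c.
Qed.

Variable n : nat.
Notation V := 'rV[R]_n.
Notation e_ i := (delta_mx 0 i : V).

Lemma is_derive_line (f : V -> R) (z v : V) (s : R) :
  derivable f (z + s *: v) v ->
  is_derive s (1 : R) (fun t : R => f (z + t *: v)) ('D_v f (z + s *: v)).
Proof.
move=> df.
have E : (fun h : R => h^-1 *: (((fun t : R => f (z + t *: v)) \o shift s) (h *: (1 : R))
             - f (z + s *: v))) =
         (fun h : R => h^-1 *: ((f \o shift (z + s *: v)) (h *: v) - f (z + s *: v))).
  apply/funext => h /=; congr (_ *: (f _ - _)).
  by rewrite scalerDl addrCA /GRing.scale /= mulr1.
by split; rewrite /derivable /derive E.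
Qed.

(** Walk from [x] to [y] changing one coordinate at a time, apply the one-variable mean value
    theorem on each edge, and telescope. *)
Lemma mean_value_rV (f : V -> R) (x y : V) :
  (forall z v, derivable f z v) ->
  exists2 c : 'I_n -> V,
    forall i j, `|c i 0 j - x 0 j| <= `|y 0 j - x 0 j| &
    f y - f x = \sum_i (y 0 i - x 0 i) * 'D_(e_ i) f (c i).
Proof.
move=> df.
(* The vertices of the path: [z 0] is [x] and [z n] is [y]. *)
pose z (k : nat) : V := \row_j if (j < k)%N then y 0 j else x 0 j.
have zS (k : 'I_n) : z k.+1 = z k + (y 0 k - x 0 k) *: e_ k.
  apply/rowP => j; rewrite !mxE eqxx /= ltnS leq_eqVlt (inj_eq val_inj).
  have [->|jk] := eqVneq j k; first by rewrite ltnn mulr1 addrC subrK.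
  by rewrite mulr0 addr0.
have step (k : 'I_n) : exists c : V,
    (forall j, `|c 0 j - x 0 j| <= `|y 0 j - x 0 j|) /\
    f (z k.+1) - f (z k) = (y 0 k - x 0 k) * 'D_(e_ k) f c.
  pose h := y 0 k - x 0 k.
  have [t tb E] := @MVT_minmax (fun t => f (z k + t *: e_ k))
    (fun t => 'D_(e_ k) f (z k + t *: e_ k)) 0 h
    (fun t _ => is_derive_line (df _ _)).
  exists (z k + t *: e_ k); split; last first.
    by move: E; rewrite scale0r addr0 subr0 -zS mulrC.
  move=> j; rewrite !mxE eqxx /=.
  have [->|jk] := eqVneq j k; last first.
    by rewrite mulr0 addr0; case: ifP; rewrite ?subrr ?normr0.
  rewrite ltnn mulr1 addrAC subrr add0r -/h.
  move: tb; have [h0|h0] := leP 0 h; move=> /andP[t1 t2].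
    by rewrite !ger0_norm.
  by rewrite !ler0_norm ?lerN2// ltW.
have [c cP] := choice step; exists c => [i j|]; first exact: (cP i).1.
rewrite (eq_bigr (fun k : 'I_n => f (z k.+1) - f (z k))); last first.
  by move=> k _; rewrite (cP k).2.
rewrite -(big_mkord xpredT (fun k => f (z k.+1) - f (z k))) telescope_sumr//.
by congr (f _ - f _); apply/rowP => j; rewrite mxE ?ltn_ord.
Qed.

Lemma is_deriveP (f : R -> R) (t l : R) :
  is_derive t (1 : R) f l <-> (h^-1 * (f (h + t) - f t)) @[h --> 0^'] --> l.
Proof.
have E : (fun h : R => h^-1 *: ((f \o shift t) (h *: (1 : R)) - f t)) =
         (fun h => h^-1 * (f (h + t) - f t)).
  by apply/funext => h /=; rewrite /GRing.scale /= mulr1.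
split=> [[df <-]|H]; first by move: df; rewrite /derive /derivable E.
by split; rewrite /derivable /derive E; [exact: cvgP H|exact: cvg_lim H].
Qed.

(** A chain rule from continuous directional derivatives alone: [mean_value_rV] splits the
    difference quotient over the coordinates, and its intermediate points are squeezed to [g t]. *)
Lemma is_derive_curve (f : V -> R) (g : R -> V) (dg : 'I_n -> R) (t : R) :
  (forall z v, derivable f z v) -> (forall v, continuous ('D_v f)) ->
  (forall i, is_derive t (1 : R) (fun s => g s 0 i) (dg i)) ->
  is_derive t (1 : R) (f \o g) (\sum_i dg i * 'D_(e_ i) f (g t)).
Proof.
move=> df cdf dgP; apply/is_deriveP.
have /choice[c cP] : forall h : R, exists c : 'I_n -> V,
    (forall i j, `|c i 0 j - g t 0 j| <= `|g (h + t) 0 j - g t 0 j|) /\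
    f (g (h + t)) - f (g t) = \sum_i (g (h + t) 0 i - g t 0 i) * 'D_(e_ i) f (c i).
  by move=> h; have [c c1 c2] := mean_value_rV (g t) (g (h + t)) df; exists c.
have gc i : (g (h + t) 0 i) @[h --> (0 : R)^'] --> g t 0 i.
  have [/derivable1_diffP /differentiable_continuous] := dgP i.
  by move=> /continuous_withinNshiftx.
have cc i : c h i @[h --> (0 : R)^'] --> g t.
  apply/cvg_ballP => e e0.
  have : \forall h \near (0 : R)^', forall j, `|g t 0 j - g (h + t) 0 j| < e.
    by apply: filter_forall => j; have /cvgrPdist_lt := gc j; exact.
  apply: filterS => h H; apply/rV_ballE => // j.
  by rewrite distrC (le_lt_trans ((cP h).1 i j))// distrC.
rewrite (_ : (fun h => _) = (fun h => \sum_i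
    (h^-1 * (g (h + t) 0 i - g t 0 i)) * 'D_(e_ i) f (c h i))); last first.
  apply/funext => h; rewrite /= (cP h).2 mulr_sumr.
  by apply: eq_bigr => i _; rewrite mulrA.
apply: (cvg_big add_continuous) => i _; apply: cvgM; first exact/is_deriveP.
exact: (cvg_comp _ _ (cc i) (cdf (e_ i) (g t))).
Qed.

End MeanValue.

(** * The generator of the dilations and the radial derivative *)

Section Euler.
Variables (R : realType) (n : nat) (w : 'I_n -> R).
Notation V := 'rV[R]_n.

Definition euler (f : V -> R) (x : V) : R :=
  \sum_i w i * x 0 i * 'D_(delta_mx 0 i) f x.

Lemma smooth_derivable (f : V -> R) z v : smooth f -> derivable f z v.
Proof. by move=> /(_ [::]) [_ +]; exact. Qed.

Lemma smooth_continuous (f : V -> R) : smooth f -> continuous f.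
Proof. by move=> /(_ [::]) []. Qed.

Lemma smooth_derive_continuous (f : V -> R) v : smooth f -> continuous ('D_v f).
Proof. by move=> /(_ [:: v]) []. Qed.

Lemma euler_continuous (f : V -> R) : smooth f -> continuous (euler f).
Proof.
move=> sf; apply: (continuous_big add_continuous) => i _; apply: continuous_mulr.
  by apply: continuous_mulr; [exact: continuous_cstr|exact: coord_continuous].
exact: smooth_derive_continuous.
Qed.

(** Coordinate [i] of the orbit is a multiple of the power [w i] of [r], so its derivative is
    [w i / r] times itself; the chain rule then produces [euler] at the dilated point. *)
Lemma is_derive_hdil (f : V -> R) (x : V) (r : R) : smooth f -> 0 < r ->
  is_derive r (1 : R) (fun s => f (hdil w s x)) (r^-1 * euler f (hdil w r x)).
Proof.
move=> sf r0.
have H : is_derive r (1 : R) (f \o (fun s => hdil w s x))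
    (\sum_i (w i * r `^ (w i - 1) * x 0 i) * 'D_(delta_mx 0 i) f (hdil w r x)).
  apply: is_derive_curve.
  - by move=> z v; exact: smooth_derivable.
  - by move=> v; exact: smooth_derive_continuous.
  - move=> i; rewrite (_ : (fun s => _) = (fun s => x 0 i * s `^ w i)); last first.
      by apply/funext => s; rewrite mxE mulrC.
    have := is_derive1_powR (w i) r0 => D.
    by apply: is_derive_eq; rewrite /GRing.scale /= mulrC.
apply: is_derive_eq; rewrite /euler mulr_sumr; apply: eq_bigr => i _.
rewrite mxE powRB; last by apply/implyP => _; rewrite gt_eqF.
by rewrite powRr1 ?ltW//; ring.
Qed.

Lemma hdil0 r : hdil w r 0 = 0.
Proof. by apply/rowP => i; rewrite !mxE mulr0. Qed.

Lemma hdil1 x : hdil w 1 x = x.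
Proof. by apply/rowP => i; rewrite !mxE powR1 mul1r. Qed.

Lemma hdilM r s x : 0 <= r -> 0 <= s -> hdil w r (hdil w s x) = hdil w (r * s) x.
Proof. by move=> r0 s0; apply/rowP => i; rewrite !mxE powRM// mulrA. Qed.

Lemma radial_derivE inv qn (f : V -> R) x : is_quasi_norm w inv qn -> smooth f ->
  radial_deriv_R w qn f x = (qn x)^-1 * euler f x.
Proof.
move=> [_ qge0 _ _ q0] sf; rewrite /radial_deriv_R.
(* At the origin the orbit is constant, so the derivative is 0, which agrees with the convention
   that the inverse of 0 is 0. *)
have [qx0|qx0] := eqVneq (qn x) 0.
  rewrite qx0 invr0 mul0r (_ : x = 0); last exact/q0.
  rewrite (_ : (fun r => _) = cst (f 0)) ?derive1_cst//.
  by apply/funext => r; rewrite !hdil0.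
have {}qx0 : 0 < qn x by rewrite lt_def qx0 qge0.
rewrite derive1E; have := is_derive_hdil (hdil w (qn x)^-1 x) sf qx0.
move=> [_ ->]; rewrite hdilM ?invr_ge0 ?ltW//.
by rewrite divff ?gt_eqF// hdil1.
Qed.

End Euler.

(** * Powers of the modulus and C_p *)

Section PowerNorm.
Variable R : realType.
Implicit Types (a b k p : R).

Definition nrm2 a b : R := Num.sqrt (a ^+ 2 + b ^+ 2).

Lemma sqr_nrm2 a b : nrm2 a b ^+ 2 = a ^+ 2 + b ^+ 2.
Proof. by rewrite sqr_sqrtr// addr_ge0// sqr_ge0. Qed.

Lemma nrm2_ge0 a b : 0 <= nrm2 a b.
Proof. exact: sqrtr_ge0. Qed.

Lemma nrm2_eq0 a b : (nrm2 a b == 0) = (a == 0) && (b == 0).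
Proof.
by rewrite -sqrf_eq0 sqr_nrm2 paddr_eq0 ?sqr_ge0// !sqrf_eq0.
Qed.

Lemma nrm2C a b : nrm2 a b = nrm2 b a.
Proof. by rewrite /nrm2 addrC. Qed.

Lemma ler_nrm2 a b : `|a| <= nrm2 a b.
Proof. by rewrite -sqrtr_sqr ler_wsqrtr// lerDl sqr_ge0. Qed.

Lemma nrm2_le a b : nrm2 a b <= `|a| + `|b|.
Proof.
rewrite -(ler_pXn2r (n := 2)) ?nnegrE ?nrm2_ge0 ?addr_ge0//.
rewrite sqr_nrm2 sqrrD !real_normK ?num_real// -addrA lerD2l lerDr.
by rewrite mulrn_wge0// mulr_ge0.
Qed.

Lemma nrm2_scale a b k : 0 <= k -> nrm2 (a * k) (b * k) = nrm2 a b * k.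
Proof.
move=> k0; rewrite /nrm2 !exprMn -mulrDl sqrtrM ?addr_ge0 ?sqr_ge0//.
by rewrite sqrtr_sqr ger0_norm.
Qed.

Lemma powR_nrm2 a b p : nrm2 a b `^ p = (a ^+ 2 + b ^+ 2) `^ (p / 2).
Proof.
by rewrite /nrm2 -powR12_sqrt ?addr_ge0 ?sqr_ge0// -powRrM mulrC.
Qed.

Lemma powR_sub2_sqr (x p : R) : 0 <= x -> 1 < p -> x `^ (p - 2) * x ^+ 2 = x `^ p.
Proof.
move=> + p1; rewrite le_eqVlt => /predU1P[<-|x0].
  by rewrite expr2 !mulr0 powR0//; apply/eqP; lra.
rewrite -powR_mulrn ?(ltW x0)// -powRD ?subrK//.
by apply/implyP => _; rewrite gt_eqF.
Qed.

Lemma powR_sub2_mul (x p : R) : 0 <= x -> 1 < p -> x `^ (p - 2) * x = x `^ (p - 1).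
Proof.
move=> + p1; rewrite le_eqVlt => /predU1P[<-|x0].
  by rewrite mulr0 powR0//; apply/eqP; lra.
rewrite -[X in _ * X]powRr1 ?(ltW x0)// -powRD; first by congr (_ `^ _); lra.
by apply/implyP => _; rewrite gt_eqF.
Qed.

Lemma powR_continuous_gt0 p (x : R) : 0 < x -> {for x, continuous (fun y : R => y `^ p)}.
Proof.
move=> x0; have [/derivable1_diffP] := is_derive1_powR p x0.
by move=> /differentiable_continuous.
Qed.

Lemma continuous_normr_powR p : 0 < p -> continuous (fun y : R => `|y| `^ p).
Proof.
move=> p0 x; have [->|x0] := eqVneq x 0.
  rewrite /continuous_at normr0 powR0 ?gt_eqF//.
  apply/cvgrPdist_lt => e e0.
  apply/nbhs_ballP; exists (e `^ p^-1); first exact: powR_gt0.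
  move=> y; rewrite /ball /= sub0r normrN => ye.
  rewrite sub0r normrN ger0_norm ?powR_ge0//.
  rewrite [ltRHS](_ : e = (e `^ p^-1) `^ p); last first.
    by rewrite -powRrM mulVf ?gt_eqF// powRr1// ltW.
  by rewrite gt0_ltr_powR// nnegrE ?powR_ge0.
apply: (@continuous_comp R R R (fun y : R => `|y|) (fun y : R => y `^ p)).
  exact: norm_continuous.
by apply: powR_continuous_gt0; rewrite normr_gt0.
Qed.

Lemma continuous_nrm2 (T : topologicalType) (f g : T -> R) :
  continuous f -> continuous g -> continuous (fun x => nrm2 (f x) (g x)).
Proof.
move=> cf cg x; rewrite /nrm2.
apply: (@continuous_comp T R R (fun x => f x ^+ 2 + g x ^+ 2) Num.sqrt).
  apply: (@continuous_addr R T (fun x => f x ^+ 2) (fun x => g x ^+ 2)).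
    exact: continuous_mulr.
  exact: continuous_mulr.
exact: sqrt_continuous.
Qed.

Lemma continuous_powR_nrm2 (T : topologicalType) (f g : T -> R) p : 0 < p ->
  continuous f -> continuous g -> continuous (fun x => nrm2 (f x) (g x) `^ p).
Proof.
move=> p0 cf cg x.
rewrite (_ : (fun x => _) = (fun y => `|y| `^ p) \o (fun x => nrm2 (f x) (g x))).
  apply: continuous_comp; first exact: continuous_nrm2.
  exact: continuous_normr_powR.
by apply/funext => y /=; rewrite ger0_norm// nrm2_ge0.
Qed.

(** For p < 2 the power alone is singular at a common zero, but the product is bounded by the power
    p - 1 of the modulus, which tends to 0 there. *)
Lemma continuous_powR_nrm2M (T : topologicalType) (f g : T -> R) p : 1 < p ->
  continuous f -> continuous g ->
  continuous (fun x => nrm2 (f x) (g x) `^ (p - 2) * f x).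
Proof.
move=> p1 cf cg x.
have [N0|N0] := eqVneq (nrm2 (f x) (g x)) 0; last first.
  apply: (@continuousM R T (fun x => nrm2 (f x) (g x) `^ (p - 2)) f x);
    last exact: cf.
  apply: (@continuous_comp T R R (fun x => nrm2 (f x) (g x)) (fun y : R => y `^ (p - 2))).
    exact: continuous_nrm2.
  by apply: powR_continuous_gt0; rewrite lt_def N0 nrm2_ge0.
have fx0 : f x = 0 by move/eqP: N0; rewrite nrm2_eq0 => /andP[/eqP].
rewrite /continuous_at fx0 mulr0; apply/cvgrPdist_lt => e e0.
have p10 : 0 < p - 1 by lra.
have /(_ x) := @continuous_powR_nrm2 _ _ _ _ p10 cf cg.
rewrite /continuous_at N0 powR0 ?gt_eqF// => /cvgrPdist_lt /(_ e e0).
apply: filterS => y; rewrite !sub0r !normrN [`|_ `^ (p - 1)|]ger0_norm ?powR_ge0//.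
apply: le_lt_trans; rewrite normrM ger0_norm ?powR_ge0//.
by rewrite -powR_sub2_mul ?nrm2_ge0// ler_wpM2l ?powR_ge0// ler_nrm2.
Qed.

(** Away from a common zero this is the chain rule for (f^2 + g^2)^(p/2). At a common zero, with N
    the modulus at h + t, the quotient is at most (|f/h| + |g/h|) N^(p-1), where the first factor
    converges and the second tends to 0. *)
Lemma is_derive_powR_nrm2 (f g : R -> R) (t f' g' p : R) : 1 < p ->
  is_derive t (1 : R) f f' -> is_derive t (1 : R) g g' ->
  is_derive t (1 : R) (fun s => nrm2 (f s) (g s) `^ p)
    (p * (nrm2 (f t) (g t) `^ (p - 2) * (f t * f' + g t * g'))).
Proof.
move=> p1 df dg.
have [N0|N0] := eqVneq (nrm2 (f t) (g t)) 0; last first.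
  rewrite (_ : (fun s => _) = (fun y : R => y `^ (p / 2)) \o (f * f + g * g)); last first.
    by apply/funext => s /=; rewrite powR_nrm2 !expr2.
  have s0 : 0 < (f * f + g * g : R -> R) t.
    rewrite -[X in _ < X](_ : nrm2 (f t) (g t) ^+ 2 = _); last first.
      by rewrite sqr_nrm2 !expr2.
    by rewrite exprn_gt0// lt_def N0 nrm2_ge0.
  have := is_derive1_powR (p / 2) s0 => D.
  apply: is_derive_eq; rewrite powR_nrm2 /GRing.scale /=.
  rewrite (_ : (f * f + g * g) t = f t ^+ 2 + g t ^+ 2) //.
  rewrite (_ : (p - 2) / 2 = p / 2 - 1); last by field.
  by field.
apply/is_deriveP.
have [f0 g0] : f t = 0 /\ g t = 0.
  by move/eqP: N0; rewrite nrm2_eq0 => /andP[/eqP-> /eqP->].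
rewrite f0 g0 !mul0r addr0 mulr0 mulr0.
have N00 : nrm2 0 0 = 0 by apply/eqP; rewrite nrm2_eq0 eqxx.
rewrite N00 powR0; last by apply/eqP; lra.
have p10 : 0 < p - 1 by lra.
have cts (k : R -> R) k' : is_derive t (1 : R) k k' -> k (h + t) @[h --> (0 : R)^'] --> k t.
  move=> [/derivable1_diffP /differentiable_continuous].
  by move=> /continuous_withinNshiftx.
have quo (k : R -> R) k' : is_derive t (1 : R) k k' -> k t = 0 ->
    `|h^-1 * k (h + t)| @[h --> (0 : R)^'] --> `|k'|.
  move=> /is_deriveP + kt0; rewrite kt0.
  by under eq_fun do rewrite subr0; move/cvg_norm.
have cN : (nrm2 (f (h + t)) (g (h + t)) `^ (p - 1)) @[h --> (0 : R)^'] --> (0 : R).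
  have H (k : R -> R) (k' : R) (dk : is_derive t (1 : R) k k') (kt : k t = 0) : 
    `|k (h + t)| @[h --> (0 : R)^'] --> (0 : R).
    by have := cts _ _ dk; rewrite kt => /cvg_norm; rewrite normr0.
  have H1 : (`| `|f (h + t)| + `|g (h + t)| | `^ (p - 1)) @[h --> (0 : R)^'] --> (0 : R).
    have /(_ (0 : R)) := continuous_normr_powR p10; rewrite /continuous_at normr0.
    rewrite powR0 ?gt_eqF// => C.
    apply: (cvg_comp _ _ _ C).
    by have := cvgD (H f _ df f0) (H g _ dg g0); rewrite addr0; exact.
  apply: (squeeze_cvgr _ (cvg_cst (0 : R)) H1).
  near=> h; rewrite powR_ge0 /= ge0_ler_powR ?nnegrE ?nrm2_ge0 ?(ltW p10)//.
  by rewrite ger0_norm ?addr_ge0 ?nrm2_le.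
have up : ((`|h^-1 * f (h + t)| + `|h^-1 * g (h + t)|) *
    nrm2 (f (h + t)) (g (h + t)) `^ (p - 1)) @[h --> (0 : R)^'] --> (0 : R).
  have := cvgM (cvgD (quo _ _ df f0) (quo _ _ dg g0)) cN.
  by rewrite mulr0; exact.
apply: norm_cvg0; apply: (squeeze_cvgr _ (cvg_cst (0 : R)) up).
near=> h; rewrite normr_ge0 /= subr0 normrM [`|_ `^ p|]ger0_norm ?powR_ge0//.
rewrite -[_ `^ p]mulr_powRB1 ?nrm2_ge0//; last by lra.
rewrite mulrA ler_wpM2r ?powR_ge0//.
by rewrite !normrM -mulrDr ler_wpM2l// nrm2_le.
Unshelve. all: by end_near. Qed.

End PowerNorm.

(** * Nonnegativity, equality case and expansion of C_p *)

Section CpTheory.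
Variable R : realType.
Implicit Types (a b c p : R) (z xi eta u v : R[i]).

Lemma young_powR a b p : 1 < p -> 0 <= a -> 0 < b ->
  p * (a * b `^ (p - 1)) <= a `^ p + (p - 1) * b `^ p ?= iff (a == b).
Proof.
(* The case [a = 0] is kept apart from the logarithms; there the inequality is strict because [b] is
   positive. *)
move=> p1; rewrite le_eqVlt => /predU1P[<-|a0] b0.
  have b0p : 0 < (p - 1) * b `^ p by rewrite mulr_gt0 ?powR_gt0// subr_gt0.
  rewrite mul0r mulr0 powR0; last by apply/eqP; lra.
  rewrite add0r; split; first exact: ltW.
  by rewrite !lt_eqF.
(* Divided by m, the inequality is p <= exp ((p - 1) d) + (p - 1) exp (- d),
   which follows from exp t >= 1 + t. *)
pose m := a * b `^ (p - 1).
pose d := ln a - ln b.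
have m0 : 0 < m by rewrite mulr_gt0// powR_gt0.
have aE : a = expR (ln a) by rewrite lnK.
have mE : m = expR (ln a + (p - 1) * ln b).
  by rewrite /m /powR gt_eqF// {1}aE -expRD.
have -> : a `^ p = m * expR ((p - 1) * d).
  by rewrite mE /powR gt_eqF// -expRD; congr expR; rewrite /d; ring.
have -> : b `^ p = m * expR (- d).
  by rewrite mE /powR gt_eqF// -expRD; congr expR; rewrite /d; ring.
rewrite -/m (mulrCA (p - 1)) -mulrDr [p * m]mulrC.
have dE : (d == 0) = (a == b).
  rewrite subr_eq0; apply/eqP/eqP => [|->//].
  by move/ln_inj => ->//; rewrite posrE.
split.
  rewrite ler_pM2l//.
  have h1 := expR_ge1Dx ((p - 1) * d).
  have h2 : (p - 1) * (1 - d) <= (p - 1) * expR (- d).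
    by rewrite ler_pM2l ?subr_gt0// expR_ge1Dx.
  move: (expR _) (expR _) h1 h2 => A B h1 h2; lra.
rewrite -dE; apply/eqP/eqP => [|->]; last first.
  by rewrite oppr0 mulr0 expR0; ring.
have mn0 : m != 0 by rewrite gt_eqF.
move/(mulfI mn0) => E.
apply/eqP; apply: contra_eqT E => d0; rewrite lt_eqF//.
have h1 := expR_ge1Dx ((p - 1) * d).
have h2 : (p - 1) * (1 - d) < (p - 1) * expR (- d).
  by rewrite ltr_pM2l ?subr_gt0// expR_gt1Dx// oppr_eq0.
move: (expR _) (expR _) h1 h2 => A B h1 h2; lra.
Qed.

Lemma cabs_eq0 z : (cabs z == 0) = (z == 0).
Proof. by case: z => a b; rewrite [cabs _]/(nrm2 a b) nrm2_eq0 eq_complex. Qed.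

(* With zeta = xi - eta, Cauchy-Schwarz bounds Re (zeta * conj xi) by
   |xi| |zeta|, and the rest is Young's inequality with exponent p; equality in
   both forces xi = zeta. *)
Lemma Cp_ge0_eq0 p xi eta : 1 < p ->
  0 <= Cp p xi eta /\ (Cp p xi eta = 0 -> eta = 0).
Proof.
move=> p1; have p0 : p != 0 by apply/eqP; lra.
rewrite /Cp; have [->|ne] := eqVneq xi eta.
  rewrite subrr [cabs 0](_ : _ = 0); last by apply/eqP; rewrite cabs_eq0.
  rewrite powR0// !subr0; split; first exact: powR_ge0.
  by move=> /powR_eq0_eq0 /eqP; rewrite cabs_eq0 => /eqP.
rewrite (_ : eta = xi - (xi - eta)); last by rewrite opprB addrC subrK.
have : xi - eta != 0 by rewrite subr_eq0.
set zeta := xi - eta; rewrite opprB [xi + _]addrC subrK => z0.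
have b0 : 0 < cabs zeta by rewrite lt_def cabs_eq0 z0 nrm2_ge0.
have a0 : 0 <= cabs xi by exact: nrm2_ge0.
have [yle yeq] := young_powR p1 a0 b0.
pose r := complex.Re (zeta * conjc xi).
have reE : complex.Re (zeta * conjc (xi - zeta)) = r - cabs zeta ^+ 2.
  rewrite /r /cabs sqr_sqrtr ?addr_ge0 ?sqr_ge0//.
  by case: (xi) (zeta) => [x1 x2] [y1 y2] /=; ring.
have dist : cabs (xi - zeta) ^+ 2 = cabs xi ^+ 2 + cabs zeta ^+ 2 - 2 * r.
  rewrite /r /cabs !sqr_sqrtr ?addr_ge0 ?sqr_ge0//.
  by case: (xi) (zeta) => [x1 x2] [y1 y2] /=; ring.
have CS : r <= cabs xi * cabs zeta.
  have [r0|r0] := leP r 0; first by rewrite (le_trans r0)// mulr_ge0// ltW.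
  rewrite -(ler_pXn2r (n := 2)) ?nnegrE ?(ltW r0) ?mulr_ge0 ?(ltW b0)//.
  rewrite exprMn /r /cabs !sqr_sqrtr ?addr_ge0 ?sqr_ge0// -subr_ge0.
  case: (xi) (zeta) => [x1 x2] [y1 y2] /=.
  (* Lagrange's identity: the defect in Cauchy-Schwarz is a square. *)
  by rewrite [leRHS](_ : _ = (x1 * y2 - x2 * y1) ^+ 2) ?sqr_ge0//; ring.
have bp2 : 0 < cabs zeta `^ (p - 2) by rewrite powR_gt0.
have E1 := powR_sub2_sqr (ltW b0) p1.
have E2 := powR_sub2_mul (ltW b0) p1.
have -> : cabs xi `^ p - cabs zeta `^ p -
   p * cabs zeta `^ (p - 2) * complex.Re (zeta * conjc (xi - zeta)) =
   (cabs xi `^ p + (p - 1) * cabs zeta `^ p - p * (cabs xi * cabs zeta `^ (p - 1)))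
   + p * cabs zeta `^ (p - 2) * (cabs xi * cabs zeta - r).
  by rewrite reE -E1 -E2; ring.
have t2 : 0 <= p * cabs zeta `^ (p - 2) * (cabs xi * cabs zeta - r).
  by rewrite mulr_ge0 ?subr_ge0// mulr_ge0 ?powR_ge0//; lra.
have t1 : 0 <= cabs xi `^ p + (p - 1) * cabs zeta `^ p -
   p * (cabs xi * cabs zeta `^ (p - 1)) by rewrite subr_ge0.
split; first exact: addr_ge0.
move/eqP; rewrite paddr_eq0// subr_eq0 [X in X && _]eq_sym yeq => /andP[/eqP ab].
rewrite mulf_eq0 mulf_eq0 (negPf p0) gt_eqF//= subr_eq0 => /eqP rE.
apply/eqP; rewrite -cabs_eq0 -sqrf_eq0 dist -rE ab; apply/eqP; ring.
Qed.

Lemma Cp_ge0 p xi eta : 1 < p -> 0 <= Cp p xi eta.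
Proof. by move=> p1; have [] := Cp_ge0_eq0 xi eta p1. Qed.

Lemma Cp_eq0 p xi eta : 1 < p -> Cp p xi eta = 0 -> eta = 0.
Proof. by move=> p1; have [] := Cp_ge0_eq0 xi eta p1. Qed.

Lemma CpE p c u v : 1 < p ->
  Cp p v (v + RC c * u) = cabs v `^ p + (p - 1) * (`|c| `^ p * cabs u `^ p) +
    p * (`|c| `^ (p - 2) * c) * (cabs u `^ (p - 2) * complex.Re u * complex.Re v +
                               cabs u `^ (p - 2) * complex.Im u * complex.Im v).
Proof.
move=> p1; have p0 : p != 0 by apply/eqP; lra.
rewrite /Cp -[v == _]subr_eq0 opprD addrA subrr add0r oppr_eq0.
have cu : cabs (- (RC c * u)) = `|c| * cabs u.
  rewrite /cabs -sqrtr_sqr -sqrtrM ?sqr_ge0//; congr Num.sqrt.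
  by case: u => [u1 u2] /=; ring.
rewrite cu powRM ?nrm2_ge0//.
(* The branch where the last term of [Cp] is 0 by convention: then [c = 0] or [u = 0], and the cross
   term on the right vanishes in either case. *)
have [E|ne] := eqVneq (RC c * u) 0.
  have : `|c| * cabs u = 0 by rewrite -cu E; apply/eqP; rewrite cabs_eq0 oppr0.
  move=> /eqP; rewrite mulf_eq0 normr_eq0 cabs_eq0 => /orP[/eqP->|/eqP->].
    by rewrite normr0 powR0// !(mul0r, mulr0, addr0, subr0).
  rewrite [cabs 0](_ : _ = 0); last by apply/eqP; rewrite cabs_eq0.
  by rewrite /= powR0// !(mul0r, mulr0, addr0, subr0).
have E1 := powR_sub2_sqr (nrm2_ge0 _ _ : 0 <= cabs u) p1.
have E2 : `|c| `^ (p - 2) * c ^+ 2 = `|c| `^ p.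
  by rewrite -(powR_sub2_sqr _ p1)// real_normK ?num_real.
rewrite powRM ?nrm2_ge0// -E1 -E2 /cabs sqr_sqrtr ?addr_ge0 ?sqr_ge0//.
by case: (u) (v) => [u1 u2] [v1 v2] /=; ring.
Qed.

End CpTheory.

(** * Weighted integrals and dilations *)

Lemma continuous_rV (R : realType) n (T : topologicalType) (F : T -> 'rV[R]_n) :
  (forall i, continuous (fun x => F x 0 i)) -> continuous F.
Proof.
move=> cF x; apply/cvg_ballP => e e0.
have : \forall y \near x, forall i, `|F x 0 i - F y 0 i| < e.
  by apply: filter_forall => i; exact: continuous_dist_lt (cF i x) e0.
by apply: filterS => y H; apply/rV_ballE.
Qed.

Section Weighted.
Variables (R : realType) (n : nat) (w : 'I_n -> R).
Variables (inv : 'rV[R]_n -> 'rV[R]_n) (qn : 'rV[R]_n -> R).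
Notation V := 'rV[R]_n.
Hypothesis w_gt0 : forall i, 0 < w i.
Hypothesis qnP : is_quasi_norm w inv qn.
Implicit Types (K : set V) (g k h : V -> R) (M e b r alpha : R) (x : V).

Lemma compact_box K : compact K ->
  exists2 M : R, 0 <= M & forall x i, M < `|x 0 i| -> ~ K x.
Proof.
move=> /compact_bounded[M0 [_ MP]].
exists (Num.max 0 (M0 + 1)); first by rewrite le_max lexx.
move=> x i xM Kx; move: xM; apply/negP; rewrite -leNgt.
have M01 : M0 < M0 + 1 by rewrite ltrDl.
rewrite (@le_trans _ _ (M0 + 1)) ?le_max ?lexx ?orbT//.
apply: le_trans (MP _ M01 _ Kx); rewrite [leRHS]/Num.norm /= mx_normrE.
by apply/bigmax_geP; right; exists (0, i).
Qed.

Lemma csupp_bounded M g : csupp M g -> exists B : R, forall x, `|g x| <= B.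
Proof.
move=> [cg g0].
have cb : compact [set x : V | forall i, `|x 0 i| <= M] by exact: box_compact.
have : compact (g @` [set x : V | forall i, `|x 0 i| <= M]).
  by apply: continuous_compact cb; exact: continuous_subspaceT.
move=> /compact_bounded[B0 [_ BP]].
exists (Num.max 0 (B0 + 1)) => x.
have [xM|] := pselect (forall i, `|x 0 i| <= M).
  rewrite le_max (BP (B0 + 1)) ?orbT ?ltrDl//; by exists x.
move=> /existsNP[i /negP]; rewrite -ltNge => /g0 ->.
by rewrite normr0 le_max lexx.
Qed.

Lemma qn_gt0 x : x != 0 -> 0 < qn x.
Proof.
case: qnP => _ q0 _ _ qE x0; rewrite lt_def q0 andbT.
by apply: contra x0 => /eqP/qE ->.
Qed.

Lemma near_compact_eq0 K h x : compact K -> (forall y, ~ K y -> h y = 0) ->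
  ~ K x -> \forall y \near x, h y = 0.
Proof.
move=> cK h0 Kx.
have oK : open (~` K).
  by rewrite openC; apply: compact_closed cK; exact: norm_hausdorff.
have : \forall y \near x, (~` K) y by exact: open_nbhs_nbhs.
by apply: filterS => y; exact: h0.
Qed.

(** The weight can be discontinuous only at the origin, and [h] vanishes in a neighbourhood of it
    because [K] is closed and misses 0. *)
Lemma csupp_weight K M h b : compact K -> ~ K 0 ->
  (forall x i, M < `|x 0 i| -> ~ K x) ->
  continuous h -> (forall x, ~ K x -> h x = 0) ->
  csupp M (fun x => h x * qn x `^ b).
Proof.
move=> cK K0 KM ch h0; split; last first.
  by move=> x i /KM /h0 ->; rewrite mul0r.
move=> x; have [->|x0] := eqVneq x 0.
  apply: (near_cst_continuous 0).
  by have := near_compact_eq0 cK h0 K0; apply: filterS => y ->; rewrite mul0r.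
apply: (@continuousM R V h (fun x => qn x `^ b) x); first exact: ch.
apply: (@continuous_comp V R R qn (fun y : R => y `^ b)).
  by case: qnP => + _ _ _ _; exact.
by apply: powR_continuous_gt0; exact: qn_gt0.
Qed.

Lemma euler_eq0 K h x : compact K -> (forall y, ~ K y -> h y = 0) ->
  ~ K x -> euler w h x = 0.
Proof.
move=> cK h0 Kx; rewrite /euler big1// => i _.
rewrite (@near_eq_derive _ _ _ _ (cst 0)) ?derive_cst ?mulr0//.
exact: near_compact_eq0 cK h0 Kx.
Qed.

Lemma qn_hdil_powR r x b : 0 < r ->
  qn (hdil w r x) `^ b = r `^ b * qn x `^ b.
Proof. by move=> r0; case: qnP => _ q0 _ -> // _; rewrite powRM// ltW. Qed.

Lemma hdil_continuous r : continuous (hdil w r).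
Proof.
apply: continuous_rV => i; under eq_fun do rewrite mxE.
by apply: continuous_mulr; [exact: continuous_cstr|exact: coord_continuous].
Qed.

(* A dilation of ratio at least 1/2 shrinks no coordinate by more than this
   factor. *)
Definition hdil_cst : R := \sum_i 2 `^ w i + 1.

Lemma hdil_cst_ge1 : 1 <= hdil_cst.
Proof. by rewrite lerDr sumr_ge0// => i _; rewrite powR_ge0. Qed.

(** A single box serves all these ratios, so that dilates can be combined under one integral near
    ratio 1. *)
Lemma csupp_hdil M g r : 0 <= M -> csupp M g -> 2^-1 <= r ->
  csupp (hdil_cst * M) (fun x => g (hdil w r x)).
Proof.
move=> M0 [cg g0] r2; split.
  move=> x; apply: (@continuous_comp V V R (hdil w r) g).
    exact: hdil_continuous.
  exact: cg.
move=> x i xM; apply: (g0 _ i); rewrite mxE normrM ger0_norm ?powR_ge0//.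
have c0 : 0 < 2 `^ w i :> R by rewrite powR_gt0.
have cC : 2 `^ w i <= hdil_cst.
  rewrite /hdil_cst (bigD1 i)//= -addrA lerDl.
  by apply: addr_ge0 => //; apply: sumr_ge0 => j _; exact: powR_ge0.
have rc : (2 `^ w i)^-1 <= r `^ w i.
  have -> : (2 `^ w i)^-1 = (2^-1) `^ (w i) :> R.
    by rewrite -(@powR_inv1 _ 2)// -powRrM mulN1r powRN.
  by apply: ge0_ler_powR => //; rewrite ?nnegrE ?(le_trans _ r2)// ltW.
have xM2 : 2 `^ w i * M < `|x 0 i| by apply: le_lt_trans xM; rewrite ler_wpM2r.
rewrite -(ltr_pM2l (x := 2 `^ w i)) ?powR_gt0//; apply: (lt_le_trans xM2).
by rewrite mulrA ler_peMl// -ler_pdivrMl// mulr1.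
Qed.

(** The error splits into a displacement term, small by uniform continuity since coordinates in the
    larger box move by at most |1 - r^(w i)| times its half-width, and a factor 1 - r^b times a
    bounded value. Outside the larger box both functions vanish. *)
Lemma near_hdil_unif M g b e : 0 <= M -> csupp M g -> 0 < e ->
  \forall r \near (1 : R), forall x, `|r `^ b * g (hdil w r x) - g x| < e.
Proof.
move=> M0 cg e0; have [B BP] := csupp_bounded cg.
have e20 : 0 < e / 2 by lra.
have [d d0 dP] := csupp_unif cg e20.
have B0 : 0 < B + 1 by rewrite ltr_wpDl// (le_trans _ (BP 0)).
pose M' := hdil_cst * M.
have M'0 : 0 < M' + 1.
  by rewrite ltr_wpDl// mulr_ge0// (le_trans _ hdil_cst_ge1).
have MM' : M <= M' by rewrite ler_peMl// hdil_cst_ge1.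
have pow1 (c e1 : R) : 0 < e1 -> \forall r \near (1 : R), `|1 - r `^ c| < e1.
  move=> e10; have := @powR_continuous_gt0 R c 1 ltr01.
  by move=> /continuous_dist_lt /(_ e10); rewrite powR1.
near=> r => x.
have r2 : 2^-1 <= r.
  by apply/ltW; near: r; apply: lt_nbhsr; lra.
have rb : `|1 - r `^ b| < e / 2 / (B + 1).
  by near: r; apply: pow1; rewrite divr_gt0.
have rw : forall i, `|1 - r `^ w i| < d / (M' + 1).
  by near: r; apply: filter_forall => i; apply: pow1; rewrite divr_gt0.
have [xM|] := pselect (forall i, `|x 0 i| <= M'); last first.
  move=> /existsNP[i /negP]; rewrite -ltNge => xM.
  rewrite ((csupp_hdil M0 cg r2).2 _ _ xM) (cg.2 _ i) ?(le_lt_trans MM')//.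
  by rewrite mulr0 subrr normr0.
have gd : `|g (hdil w r x) - g x| < e / 2.
  apply: dP => i; rewrite mxE -[X in _ - X]mul1r -mulrBl normrM distrC.
  have := rw i; rewrite ltr_pdivlMr//; apply: le_lt_trans.
  by rewrite ler_wpM2l// (le_trans (xM i))// lerDl.
rewrite (_ : _ - _ = (g (hdil w r x) - g x) - (1 - r `^ b) * g (hdil w r x));
  last by ring.
rewrite (le_lt_trans (ler_normB _ _))// [ltRHS]splitr ltr_leD// normrM.
move: rb; rewrite ltr_pdivlMr// => /ltW; apply: le_trans.
by rewrite ler_wpM2l// (le_trans (BP _))// lerDl.
Unshelve. all: by end_near. Qed.

(* Both sides are the derivative at l = 1 of
   l |-> Gint (fun x => g (hdil w l x) * qn x `^ (- alpha)), computed under the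
   integral sign and from the scaling rule Gint_dil. *)
Lemma Gint_euler K M alpha g k : compact K -> ~ K 0 -> 0 <= M ->
  (forall x i, M < `|x 0 i| -> ~ K x) ->
  continuous g -> (forall x, ~ K x -> g x = 0) ->
  continuous k -> (forall x, ~ K x -> k x = 0) ->
  (forall x r, 0 < r ->
     is_derive r (1 : R) (fun s => g (hdil w s x)) (r^-1 * k (hdil w r x))) ->
  Gint (fun x => k x * qn x `^ (- alpha)) =
  (alpha - hdim w) * Gint (fun x => g x * qn x `^ (- alpha)).
Proof.
move=> cK K0 M0 KM cg g0 ck k0 dgk.
pose gW := fun x => g x * qn x `^ (- alpha).
pose kW := fun x => k x * qn x `^ (- alpha).
have cgW : csupp M gW by exact: csupp_weight cK K0 KM cg g0.
have ckW : csupp M kW by exact: csupp_weight cK K0 KM ck k0.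
rewrite -/gW -/kW; set A := Gint gW; set B := Gint kW.
pose M' := hdil_cst * M.
have M'0 : 0 <= M' by rewrite mulr_ge0// (le_trans _ hdil_cst_ge1).
have MM' : M <= M' by rewrite ler_peMl// hdil_cst_ge1.
pose phi := fun l : R => A * l `^ (alpha - hdim w).
have D1 : is_derive (1 : R) (1 : R) phi ((alpha - hdim w) * A).
  have := is_derive1_powR (alpha - hdim w) (ltr01 : 0 < 1 :> R) => D.
  by apply: is_derive_eq; rewrite powR1 mulr1 mulrC.
suff D2 : is_derive (1 : R) (1 : R) phi B by case: D1 => _ <-; case: D2.
apply/is_deriveP; apply/cvgrPdist_lt => e e0.
pose T := (2 * M') ^+ n.
have T0 : 0 <= T by rewrite exprn_ge0// mulr_ge0.
have T10 : 0 < T + 1 by rewrite ltr_wpDl.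
have e'0 : 0 < e / (T + 1) by rewrite divr_gt0.
(* The exponent [alpha - 1] collects the factor 1/c from the derivative along the orbit and c^alpha
   from moving the weight to the dilated point. *)
have /nbhs_ballP[d /= d0 dP] := near_hdil_unif (alpha - 1) M0 ckW e'0.
near=> h.
have h0 : h != 0 by near: h; exact: nbhs_dnbhs_neq.
have hd : `|h| < d by near: h; exact: dnbhs0_lt.
have h2 : `|h| < 2^-1 by near: h; apply: dnbhs0_lt; lra.
pose l := h + 1.
have l2 : 2^-1 <= l by move: h2; rewrite ltr_norml /l => /andP[? ?]; lra.
have l0 : 0 < l by lra.
(* The first-order remainder under the integral sign; its integral is [A - phi l + h * B], which has
   to be o(h). *)
pose G := fun x => (gW x + - l `^ alpha * gW (hdil w l x)) + h * kW x.
have cG1 := csupp_le MM' cgW; have cG2 := csupp_hdil M0 cgW l2.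
have cG12 := csupp_lin (- l `^ alpha) cG1 cG2.
have cG3 := csupp_le MM' ckW.
have GE : Gint G = A - phi l + h * B.
  rewrite /G (Gint_lin h M'0 cG12 cG3) (Gint_lin _ M'0 cG1 cG2).
  rewrite (Gint_dil w M0 cgW l0) -/A -/B /phi powRD.
    by ring.
  by apply/implyP => _; rewrite gt_eqF.
have Gb : `|Gint G| <= e / (T + 1) * `|h| * T.
  apply: (Gint_bound M'0 (csupp_lin h cG12 cG3)) => x.
  have min2 : 2^-1 <= Num.min 1 l by rewrite le_min l2 andbT; lra.
  have pos (r : R) : Num.min 1 l <= r <= Num.max 1 l -> 0 < r.
    by move=> /andP[+ _]; apply: lt_le_trans; apply: lt_le_trans min2.
  (* The mean value ratio [c] depends on [x], which is why the estimate [dP] has to be uniform in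
     [x]. *)
  have [c cl E] := MVT_minmax (fun r rl => dgk x r (pos _ rl)).
  have c0 : 0 < c by exact: pos cl.
  have cd : ball (1 : R) d c.
    (* Four cases for [c] between 1 and [l]: the mixed ones place it on either side of 1, the others
       make it equal to 1 or to [l]. *)
    apply: le_lt_trans hd; move: cl; rewrite ge_min le_max -opprB normrN.
    rewrite -[h](addrK 1) -/l => /andP[/orP[c1|c1] /orP[c2|c2]].
    - by have -> : c = 1 by [apply/eqP; rewrite eq_le c1 c2]; rewrite subrr normr0.
    - by rewrite !ger0_norm ?subr_ge0 ?lerB// (le_trans c1).
    - by rewrite !ler0_norm ?subr_le0 ?(le_trans c1)// lerN2 lerB.
    - by have -> : c = l by [apply/eqP; rewrite eq_le c1 c2].
  have glE : l `^ alpha * gW (hdil w l x) = g (hdil w l x) * qn x `^ (- alpha).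
    rewrite /gW qn_hdil_powR// [l `^ (- _)]powRN mulrCA; congr (_ * _).
    by rewrite mulVKf// gt_eqF// powR_gt0.
  have kcE : c `^ (alpha - 1) * kW (hdil w c x) =
      c^-1 * k (hdil w c x) * qn x `^ (- alpha).
    rewrite /kW qn_hdil_powR// mulrCA [RHS]mulrAC [RHS]mulrC; congr (_ * _).
    rewrite mulrA; congr (_ * _); rewrite -powRD.
      by rewrite -powR_inv1 ?ltW//; congr (_ `^ _); ring.
    by apply/implyP => _; rewrite gt_eqF.
  have GxE : G x = h * (kW x - c `^ (alpha - 1) * kW (hdil w c x)).
    rewrite /G mulNr glE kcE /gW /kW.
    move: E; rewrite hdil1 (_ : l - 1 = h); last by rewrite /l addrK.
    by move=> /eqP; rewrite subr_eq => /eqP ->; ring.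
  by rewrite -/(G x) GxE normrM mulrC ler_wpM2r// distrC ltW// dP.
rewrite (_ : B - _ = h^-1 * Gint G); last first.
  by rewrite GE {2}/phi powR1; field.
rewrite normrM normfV mulrC ltr_pdivrMr ?normr_gt0//.
apply: le_lt_trans Gb _; rewrite mulrAC ltr_pM2r ?normr_gt0//.
by rewrite mulrAC -mulrA gtr_pMr// ltr_pdivrMr// mul1r ltrDl.
Unshelve. all: by end_near. Qed.

End Weighted.

(* Along the orbit of x the function r `^ c * f (hdil w r x) has derivative 0. *)
Lemma euler_homogeneous (R : realType) n (w : 'I_n -> R) (f : 'rV[R]_n -> R)
    c r x :
  smooth f -> (forall y, euler w f y = - c * f y) -> 0 < r ->
  f x = r `^ c * f (hdil w r x).
Proof.
move=> sf fE r0.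
have [|d _] := @MVT_minmax R (fun s => s `^ c * f (hdil w s x)) (fun=> 0) 1 r.
  move=> s /andP[+ _] => sm.
  have s0 : 0 < s by apply: lt_le_trans sm; rewrite lt_min ltr01.
  have D1 := is_derive1_powR c s0; have D2 := is_derive_hdil w x sf s0.
  have D := @is_deriveM _ _ (fun s : R => s `^ c) (fun s => f (hdil w s x))
    s 1 _ _ D1 D2.
  apply: (is_derive_eq D); rewrite fE /GRing.scale /= powRB; last first.
    by apply/implyP => _; rewrite gt_eqF.
  by rewrite powRr1 ?ltW//; field; rewrite gt_eqF.
by rewrite mul0r powR1 mul1r hdil1 => /eqP; rewrite subr_eq0 => /eqP ->.
Qed.

(** * The weighted identity and the strict inequality *)

Lemma complex_mul_RC (R : realType) (z : R[i]) (r : R) :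
  z * RC r = Complex (complex.Re z * r) (complex.Im z * r).
Proof.
case: z => a b; apply/eqP; rewrite eq_complex /=.
by apply/andP; split; apply/eqP; ring.
Qed.

Theorem theorem3p3 (R : realType) (n : nat) (w : 'I_n -> R)
    (mul : 'rV[R]_n -> 'rV[R]_n -> 'rV[R]_n) (inv : 'rV[R]_n -> 'rV[R]_n)
    (qn : 'rV[R]_n -> R) (p alpha : R) (f : 'rV[R]_n -> R[i]) :
  is_homogeneous_group w mul inv ->
  is_quasi_norm w inv qn ->
  1 < p ->
  test_fun f ->
  let Q := hdim w in
  let u := fun x => f x * RC (qn x `^ (alpha / p))^-1 in
  let v := fun x => radial_deriv w qn f x * RC (qn x `^ (alpha / p - 1))^-1 in
  let lhs := `|(Q - alpha) / p| `^ p * Gint (fun x => cabs (u x) `^ p) in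
  let rhs := Gint (fun x => cabs (v x) `^ p) in
  let I := Gint (fun x => Cp p (v x) (v x + RC ((Q - alpha) / p) * u x)) in
  [/\ lhs = rhs - I,
      lhs <= rhs,
      2 <= p -> I = 0 ->
        exists phi : 'rV[R]_n -> R[i], forall x, x != 0 ->
          f x = RC (qn x `^ (- ((Q - alpha) / p))) * phi (hdil w (qn x)^-1 x) &
      2 <= p -> (exists x, f x != 0) -> lhs < rhs].
Proof.
move=> [w0 _] qnP p1 [sa [sb [K [cK K0 fK]]]] Q u v lhs rhs I.
have p0 : p != 0 by apply/eqP; lra.
have pgt0 : 0 < p by lra.
pose a x := complex.Re (f x); pose b x := complex.Im (f x).
pose Ea := euler w a; pose Eb := euler w b.
pose q x := qn x `^ (- (alpha / p)).
pose c := (Q - alpha) / p.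
have aK x : ~ K x -> a x = 0 by move=> /fK fx; rewrite /a fx.
have bK x : ~ K x -> b x = 0 by move=> /fK fx; rewrite /b fx.
have EaK x : ~ K x -> Ea x = 0 by exact: euler_eq0.
have EbK x : ~ K x -> Eb x = 0 by exact: euler_eq0.
have ca : continuous a by exact: smooth_continuous.
have cb : continuous b by exact: smooth_continuous.
have cEa : continuous Ea by exact: euler_continuous.
have cEb : continuous Eb by exact: euler_continuous.
have [M M0 KM] := compact_box cK.
have q_ge0 x : 0 <= q x by exact: powR_ge0.
have qp x : q x `^ p = qn x `^ (- alpha).
  by rewrite /q -powRrM; congr (_ `^ _); field.
have uE x : u x = Complex (a x * q x) (b x * q x).
  by rewrite /u complex_mul_RC -powRN.
have vE x : v x = Complex (Ea x * q x) (Eb x * q x).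
  rewrite /v complex_mul_RC /= !(radial_derivE _ qnP)// -/Ea -/Eb.
  (* The powers of [qn x] do not combine at the origin, but [K] misses 0 and both sides are 0
     there. *)
  have [->|x0] := eqVneq x 0; first by rewrite EaK// EbK// !(mulr0, mul0r).
  have q0 := qn_gt0 qnP x0.
  have E : (qn x)^-1 * (qn x `^ (alpha / p - 1))^-1 = q x.
    rewrite -invfM -[X in X * _]powRr1 ?ltW// -powRD.
      by rewrite /q powRN; congr ((_ `^ _)^-1); ring.
    by apply/implyP => _; rewrite gt_eqF.
  by rewrite ![(qn x)^-1 * _]mulrC -!mulrA E.
pose g x := nrm2 (a x) (b x) `^ p.
pose k x := p * (nrm2 (a x) (b x) `^ (p - 2) * (a x * Ea x + b x * Eb x)).
pose G0 x := g x * qn x `^ (- alpha).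
pose G1 x := nrm2 (Ea x) (Eb x) `^ p * qn x `^ (- alpha).
pose Gk x := k x * qn x `^ (- alpha).
have nz : nrm2 (0 : R) 0 = 0 by apply/eqP; rewrite nrm2_eq0 eqxx.
have cg : continuous g by exact: continuous_powR_nrm2.
have gK x : ~ K x -> g x = 0 by move=> Kx; rewrite /g aK// bK// nz powR0.
have ck : continuous k.
  apply: continuous_mulr; first exact: continuous_cstr.
  (* The power is grouped with [a] and with [b], since for p < 2 it need not be continuous by itself
     at the zeros of [f]. *)
  rewrite (_ : (fun x => _) = (fun x => nrm2 (a x) (b x) `^ (p - 2) * a x * Ea x +
     nrm2 (b x) (a x) `^ (p - 2) * b x * Eb x)); last first.
    by apply/funext => x; rewrite mulrDr !mulrA [nrm2 (b x) _]nrm2C.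
  by apply: continuous_addr; apply: continuous_mulr => //;
    exact: continuous_powR_nrm2M.
have kK x : ~ K x -> k x = 0.
  by move=> Kx; rewrite /k aK// bK// !mul0r addr0 !mulr0.
have sG0 : csupp M G0 by exact: (csupp_weight qnP (- alpha) cK K0 KM cg gK).
have sGk : csupp M Gk by exact: (csupp_weight qnP (- alpha) cK K0 KM ck kK).
have sG1 : csupp M G1.
  apply: (csupp_weight qnP (- alpha) cK K0 KM); first exact: continuous_powR_nrm2.
  by move=> x Kx; rewrite EaK// EbK// nz powR0.
have uG x : cabs (u x) `^ p = G0 x.
  by rewrite uE [cabs _]nrm2_scale// powRM ?nrm2_ge0// qp.
have vG x : cabs (v x) `^ p = G1 x.
  by rewrite vE [cabs _]nrm2_scale// powRM ?nrm2_ge0// qp.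
pose c1 := `|c| `^ (p - 2) * c.
have IG x : Cp p (v x) (v x + RC c * u x) =
    (G1 x + (p - 1) * `|c| `^ p * G0 x) + c1 * Gk x.
  rewrite CpE// uG vG mulrA; congr (_ + _).
  rewrite uE vE [cabs _]nrm2_scale// powRM ?nrm2_ge0// /Gk /k -/c1 -qp /=.
  by rewrite -(powR_sub2_sqr (q_ge0 x) p1) -/(nrm2 (a x) (b x)); ring.
have IE : I = Gint G1 + (p - 1) * `|c| `^ p * Gint G0 + c1 * Gint Gk.
  have sG01 := csupp_lin ((p - 1) * `|c| `^ p) sG1 sG0.
  rewrite -(Gint_lin _ M0 sG1 sG0) -(Gint_lin _ M0 sG01 sGk).
  by congr Gint; apply/funext => x; exact: IG.
(* [k] is the derivative of |f|^p along the dilations, so this is the integrated Euler identity with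
   [alpha - Q = - (p * c)]. *)
have key : Gint Gk = - (p * c) * Gint G0.
  rewrite (_ : - (p * c) = alpha - hdim w); last by rewrite /c /Q; field.
  apply: (Gint_euler w0 qnP alpha cK K0 M0 KM cg gK ck kK) => x r r0.
  have D := is_derive_powR_nrm2 p1
    (is_derive_hdil w x sa r0) (is_derive_hdil w x sb r0).
  by apply: (is_derive_eq D); rewrite /k -/Ea -/Eb; ring.
have lhsE : lhs = `|c| `^ p * Gint G0.
  by congr (_ * Gint _); apply/funext => x; exact: uG.
have rhsE : rhs = Gint G1 by congr Gint; apply/funext => x; exact: vG.
have c1E : c1 * c = `|c| `^ p.
  rewrite -(powR_sub2_sqr (normr_ge0 c) p1).
  by rewrite real_normK ?num_real// /c1; move: (_ `^ _) => t; ring.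
(* After [key], the coefficient of [Gint G0] in [I] is (p - 1)|c|^p - p c1 c = - |c|^p. *)
have eq1 : lhs = rhs - I.
  by rewrite lhsE rhsE IE key -c1E; ring.
have I0 : 0 <= I by apply: Gint_ge0 => x; exact: Cp_ge0.
(* The integrand is continuous and nonnegative, so a positive value anywhere would make [I]
   positive. Hence it vanishes identically, [v = - c u], and off the origin the weight [q] can be
   cancelled. *)
have hom : I = 0 ->
    forall x, euler w a x = - c * a x /\ euler w b x = - c * b x.
  move=> Ieq0 x.
  have [->|x0] := eqVneq x 0.
    by rewrite -/Ea -/Eb EaK// EbK// aK// bK// mulr0.
  have vu : v x + RC c * u x = 0.
    apply: (Cp_eq0 p1 (xi := v x)); apply/eqP.
    rewrite eq_le Cp_ge0// andbT leNgt; apply/negP => Cgt.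
    have : 0 < I; last by rewrite Ieq0 ltxx.
    rewrite /I (_ : (fun x => _) = (fun x =>
      (G1 x + (p - 1) * `|c| `^ p * G0 x) + c1 * Gk x)).
      apply: (@Gint_gt0 _ _ M _ x) => //.
      - by apply: csupp_lin => //; exact: csupp_lin.
      - by move=> y; rewrite -IG; exact: Cp_ge0.
      - by rewrite -IG.
    by apply/funext => y; exact: IG.
  have qx : q x != 0 by rewrite gt_eqF// powR_gt0// (qn_gt0 qnP).
  move: vu; rewrite mulrC uE vE complex_mul_RC /= => /eqP; rewrite eq_complex /=.
  move=> /andP[/eqP h1 /eqP h2].
  split; apply: (mulIf qx).
    by move: h1; rewrite -/Ea => /eqP; rewrite addr_eq0 => /eqP ->; ring.
  by move: h2; rewrite -/Eb => /eqP; rewrite addr_eq0 => /eqP ->; ring.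
have hab : I = 0 -> forall x r, 0 < r ->
    a x = r `^ c * a (hdil w r x) /\ b x = r `^ c * b (hdil w r x).
  move=> /hom H x r r0; split; apply: euler_homogeneous => // y.
    exact: (H y).1.
  exact: (H y).2.
split => //.
- by rewrite eq1 lerBlDr lerDl.
(* The profile is [f] itself, evaluated on the unit sphere: homogeneity is used with ratio 1/|x|. *)
- move=> _ /hab H; exists f => x x0.
  have q0 := qn_gt0 qnP x0.
  have qV0 : 0 < (qn x)^-1 by rewrite invr_gt0.
  rewrite mulrC complex_mul_RC; have [h1 h2] := H x _ qV0.
  have E : (qn x)^-1 `^ c = qn x `^ (- c).
    by rewrite -powR_inv1 ?ltW// -powRrM mulN1r.
  move: h1 h2; rewrite E mulrC => h1; rewrite mulrC => h2.
  by rewrite -/c -/(a _) -/(b _) -h1 -h2 /a /b; case: (f x).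
- move=> _ [x fx0]; rewrite eq1 ltrBlDr ltrDl lt_def I0 andbT.
  have x0 : x != 0 by apply: contra fx0 => /eqP ->; rewrite fK.
  apply: contra fx0 => /eqP /hab H.
  have [i xi0] : exists i, x 0 i != 0.
    apply/not_existsP => xi; case/eqP: x0; apply/rowP => i; rewrite mxE.
    by apply/eqP; apply: contrapT => /negP; exact: xi.
  have xi : 0 < `|x 0 i| by rewrite normr_gt0.
  (* This ratio brings coordinate [i] to absolute value [M + 1], outside the box containing [K], so
     [f] vanishes at the dilated point and by homogeneity at [x]. *)
  pose r := ((M + 1) / `|x 0 i|) `^ (w i)^-1.
  have M1 : 0 < M + 1 by rewrite ltr_wpDl.
  have r0 : 0 < r by rewrite powR_gt0// divr_gt0.
  have Kr : ~ K (hdil w r x).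
    apply: (KM _ i); rewrite mxE normrM ger0_norm ?powR_ge0//.
    rewrite /r -powRrM mulVf ?gt_eqF// powRr1; last by rewrite divr_ge0// ltW.
    by rewrite divfK ?gt_eqF// ltrDl.
  have [h1 h2] := H x r r0; move: h1 h2; rewrite (aK _ Kr) (bK _ Kr) !mulr0 /a /b.
  by case: (f x) => /= ? ? -> ->.
Qed.
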